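(* Let $p_1,p_2,p_3,B_1,B_2,B_3$ be admissible parameters and let $\mathcal{S}=\{S_1,S_2,S_3,S_0\}$ be the corresponding system of contraction similarities. Then the attractor $K$ of $\mathcal{S}$, i.e. the unique nonempty compact set $K\subset\mathbb{R}^2$ with $K=S_0(K)\cup S_1(K)\cup S_2(K)\cup S_3(K)$, is a dendrite.
   Context: Identify $\mathbb{R}^2$ with $\mathbb{C}$. Let $\Delta$ be the (closed, filled) triangle with vertices $A_1=0$, $A_2=1$, $A_3=e^{i\pi/3}=(1/2,\sqrt3/2)$. For positive numbers $p_1,p_2,p_3$ with $p_1+p_2+p_3<1$ put $S_1(z)=p_1z$, $S_2(z)=p_2z-p_2+1$, $S_3(z)=p_3z-p_3e^{i\pi/3}+e^{i\pi/3}$ (contracting similarities fixing $A_1,A_2,A_3$ respectively), and write $S_{ij}=S_i\circ S_j$. Let $K'$ be the attractor of $\{S_1,S_2,S_3\}$, i.e. the unique nonempty compact set with $K'=S_1(K')\cup S_2(K')\cup S_3(K')$. The parameters $p_1,p_2,p_3,B_1,B_2,B_3$ are called admissible if $p_1,p_2,p_3>0$, $p_1+p_2+p_3<1$, and $B_1,B_2,B_3$ are the vertices of an equilateral triangle with $$B_1\in K'\cap S_{12}([A_2A_3]),\quad B_2\in K'\cap S_{23}([A_1A_3]),\quad B_3\in K'\cap S_{31}([A_1A_2]),$$ where $[A_iA_j]$ denotes the closed side of $\Delta$ joining $A_i$ and $A_j$. For admissible parameters, $S_0$ is the similarity of the plane with $S_0(A_k)=B_k$, $k=1,2,3$. A dendrite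 is a locally connected continuum (nonempty compact connected metric space) containing no simple closed curve. *)

(* Defs.v *)
(* The plane is R * R, whose product topology is the usual
   topology of R^2. Its library norm is the sup norm, so the Euclidean distance
   needed for similarities and equilateral triangles is defined here. *)
From HB Require Import structures.
From mathcomp Require Import all_boot all_order all_algebra.
From mathcomp Require Import all_classical all_reals all_analysis.

Set Implicit Arguments.
Unset Strict Implicit.
Unset Printing Implicit Defensive.

Import Order.TTheory GRing.Theory Num.Theory.
Import numFieldNormedType.Exports.

Local Open Scope classical_set_scope.
Local Open Scope ring_scope.

Section Topology.
Context {R : realType} {T : topologicalType}.
Implicit Types A C : set T.

(* Local connectedness of A in its subspace topology: every point has a base of
   connected neighbourhoods V, open in A. *)
Definition locally_connected A : Prop :=
  forall x, A x -> forall U, nbhs x U ->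
    exists V : set T,
      [/\ V x, V `<=` U, connected V & exists2 W, open W & V = A `&` W].

(* The image of [0, 1] under a continuous map that is injective except for
   f 0 = f 1; for Hausdorff T these are the homeomorphic images of a circle. *)
Definition simple_closed_curve C : Prop :=
  exists f : R -> T,
    [/\ {within `[0, 1], continuous f}, f 0 = f 1,
        {in `[0, 1[ &, injective f} & C = f @` `[0, 1]].

End Topology.
Arguments simple_closed_curve R {T} C.

Section Plane.
Context {R : realType}.
Local Notation plane := (R * R)%type.

(* The metric on A is the one induced from the plane. *)
Definition dendrite (A : set plane) : Prop :=
  [/\ A !=set0, compact A, connected A, locally_connected A &
      ~ exists2 C, simple_closed_curve R C & C `<=` A].

Definition edist (z w : plane) : R :=
  Num.sqrt ((z.1 - w.1) ^+ 2 + (z.2 - w.2) ^+ 2).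

Definition similarity (f : plane -> plane) : Prop :=
  exists2 r : R, 0 < r & forall z w, edist (f z) (f w) = r * edist z w.

Definition equilateral (a b c : plane) : Prop :=
  exists2 l : R, 0 < l & [/\ edist a b = l, edist b c = l & edist c a = l].

Definition segment (a b : plane) : set plane :=
  [set (1 - t) *: a + t *: b | t in `[0, 1]].

(* By Hutchinson's theorem there is exactly one such K when the maps in fs are
   contractions and fs is nonempty. *)
Definition is_attractor (fs : seq (plane -> plane)) (K : set plane) : Prop :=
  [/\ K !=set0, compact K & K = \big[setU/set0]_(f <- fs) (f @` K)].

Definition A1 : plane := (0, 0).
Definition A2 : plane := (1, 0).
Definition A3 : plane := (1 / 2, Num.sqrt 3 / 2).

Definition S1 (p1 : R) (z : plane) : plane := p1 *: z.
Definition S2 (p2 : R) (z : plane) : plane := p2 *: z - p2 *: A2 + A2.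
Definition S3 (p3 : R) (z : plane) : plane := p3 *: z - p3 *: A3 + A3.

Definition admissible (p1 p2 p3 : R) (B1 B2 B3 : plane) : Prop :=
  [/\ [/\ 0 < p1, 0 < p2 & 0 < p3], p1 + p2 + p3 < 1, equilateral B1 B2 B3 &
      exists2 K', is_attractor [:: S1 p1; S2 p2; S3 p3] K' &
        [/\ (K' `&` (S1 p1 \o S2 p2) @` segment A2 A3) B1,
            (K' `&` (S2 p2 \o S3 p3) @` segment A1 A3) B2 &
            (K' `&` (S3 p3 \o S1 p1) @` segment A1 A2) B3]].

End Plane.

(* Main.v *)
(* Barycentric coordinates in the triangle A1 A2 A3 show that K lies in the
   triangle, that the images of K under S1, S2, S3 are pairwise disjoint, and that
   the image under S0 meets the image under Si in the single point Bi: on S0 of the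
   triangle the i-th coordinate exceeds 1 - pi nowhere and equals it only at Bi,
   because it is affine, equals 1 - pi at Bi and is smaller at the other two Bj.
   So the four pieces of K form a star with centre S0 K, glued at single points.

   Any such star-shaped self-similar set is a dendrite. It is well-chained at every
   scale, hence connected, so it is a finite union of arbitrarily small connected
   compact sets and therefore locally connected. A simple closed curve stays
   connected when one point is removed, so it cannot cross a gluing point and lies in
   one piece; pulled back by the similarity it is again a curve in K, enlarged by a
   definite factor, which cannot be repeated indefinitely. *)
Require Import Defs.
From HB Require Import structures.
From mathcomp Require Import all_boot all_order all_algebra.
From mathcomp Require Import all_classical all_reals all_analysis.
From mathcomp Require Import ring lra.

Set Implicit Arguments.
Unset Strict Implicit.
Unset Printing Implicit Defensive.

Import Order.TTheory GRing.Theory Num.Theory.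
Import numFieldNormedType.Exports.

Local Open Scope classical_set_scope.
Local Open Scope ring_scope.

(* MathComp-Analysis has an unrelated [edist]. *)
Local Notation edist := Defs.edist.

(** * Euclidean distance and the product topology of the plane *)

Section StarAttractor.
Context {R : realType}.
Local Notation plane := (R * R)%type.
Implicit Types z w : plane.

Lemma edist_ge0 z w : 0 <= edist z w.
Proof. exact: sqrtr_ge0. Qed.

Lemma edist_sqr z w : edist z w ^+ 2 = (z.1 - w.1) ^+ 2 + (z.2 - w.2) ^+ 2.
Proof. by rewrite sqr_sqrtr // addr_ge0 // sqr_ge0. Qed.

Lemma edistxx z : edist z z = 0.
Proof. by rewrite /edist !subrr expr0n addr0 sqrtr0. Qed.

Lemma norm_le_edist z w : `|z - w| <= edist z w.
Proof.
rewrite prod_normE ge_max /=.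
by apply/andP; split; rewrite -sqrtr_sqr; apply: ler_wsqrtr;
  [rewrite lerDl|rewrite lerDr]; exact: sqr_ge0.
Qed.

Lemma edist_le_norm z w : edist z w <= 2 * `|z - w|.
Proof.
have n0 := normr_ge0 (z - w).
rewrite -(ger0_norm (mulr_ge0 (ler0n R 2) n0)) -sqrtr_sqr ler_wsqrtr //.
have : `|z.1 - w.1| <= `|z - w| by rewrite prod_normE le_max lexx.
have : `|z.2 - w.2| <= `|z - w| by rewrite prod_normE le_max lexx orbT.
rewrite -(ler_sqr (x := `|z.1 - _|)) ?nnegrE // -(ler_sqr (x := `|z.2 - _|)) ?nnegrE //.
rewrite !real_normK ?num_real //.
by have := sqr_ge0 `|z - w|; rewrite exprMn; lra.
Qed.

Lemma edistC z w : edist z w = edist w z.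
Proof. by rewrite /edist -(sqrrN (z.1 - _)) -(sqrrN (z.2 - _)) !opprB. Qed.

(** Obtained from the sup norm at the cost of a factor 2. The loss is harmless because the distances
    involved are only required to be bounded or small. *)
Lemma edist_quasi_triangle v z w : edist z w <= 2 * (edist z v + edist v w).
Proof.
rewrite (le_trans (edist_le_norm _ _)) // ler_wpM2l //.
rewrite (le_trans (ler_distD v _ _)) // lerD //; exact: norm_le_edist.
Qed.

Lemma edist_eq0 z w : edist z w = 0 -> z = w.
Proof.
move=> e0; apply/eqP; rewrite -subr_eq0 -normr_le0 -e0; exact: norm_le_edist.
Qed.

Lemma nbhs_edistP z (U : set plane) :
  nbhs z U <-> exists2 e, 0 < e & forall w, edist z w < e -> U w.
Proof.
split=> [/(@nbhs_ballP R (R * R)%type)[e /= e0 eU]|[e e0 eU]].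
  exists e => // w zw; apply: eU; rewrite -ball_normE /=.
  exact: le_lt_trans (norm_le_edist _ _) zw.
apply/(@nbhs_ballP R (R * R)%type).
exists (e / 2) => /=; first by rewrite divr_gt0.
move=> w; rewrite -ball_normE /= => zw; apply: eU.
by rewrite (le_lt_trans (edist_le_norm _ _)) // mulrC -ltr_pdivlMr.
Qed.

Lemma closed_edist (Y : set plane) z : closed Y ->
  (forall e, 0 < e -> exists2 w, Y w & edist z w < e) -> Y z.
Proof.
move=> cY zY; apply: cY => U /nbhs_edistP[e e0 eU].
by have [w Yw zw] := zY e e0; exists w; split => //; exact: eU.
Qed.

Lemma compact_edist_bounded (X : set plane) z : compact X ->
  exists D, forall x, X x -> edist x z <= D.
Proof.
move=> /compact_bounded/ex_strict_bound_gt0[M M0 XM].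
exists (2 * (M + `|z|)) => x Xx.
rewrite (le_trans (edist_le_norm _ _)) // ler_wpM2l //.
by rewrite (le_trans (ler_normB _ _)) // lerD2r ltW //; exact: XM.
Qed.

(** * Contracting similarities and invariant compact sets *)

Lemma geometric_lt (r D e : R) : 0 <= r < 1 -> 0 < e ->
  exists n, r ^+ n * D < e.
Proof.
move=> /andP[r0 r1] e0.
have /cvgrPdist_lt/(_ e e0) : geometric D r x @[x --> \oo] --> 0.
  by apply: cvg_geometric; rewrite ger0_norm.
case=> n _ /(_ n (leqnn n)) /=; rewrite sub0r normrN => h.
by exists n; rewrite mulrC; exact: le_lt_trans (ler_norm _) h.
Qed.

(* [s] is the ratio; a common bound [r] for the ratios of finitely many maps is
   what makes the images of words of length [n] uniformly small. *)
Definition similarity_le (r : R) (f : plane -> plane) : Prop :=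
  exists2 s, 0 < s <= r & forall z w, edist (f z) (f w) = s * edist z w.

Lemma similarity_le_edist r f z w : similarity_le r f ->
  edist (f z) (f w) <= r * edist z w.
Proof. by move=> [s /andP[_ sr] ->]; rewrite ler_wpM2r ?edist_ge0. Qed.

Lemma similarity_le_inj r f : similarity_le r f -> injective f.
Proof.
move=> [s /andP[s0 _] fs] z w fzw; apply: edist_eq0.
have /eqP := fs z w; rewrite fzw edistxx eq_sym mulf_eq0 gt_eqF //=.
by move/eqP.
Qed.

Lemma similarity_le_continuous r f : similarity_le r f -> continuous f.
Proof.
move=> [s /andP[s0 _] fs] z U /nbhs_edistP[e e0 eU]; apply/nbhs_edistP.
exists (e / s); first by rewrite divr_gt0.
by move=> w zw; apply: eU; rewrite fs mulrC -ltr_pdivlMr.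
Qed.

Lemma similarity_le_compact r f (X : set plane) : similarity_le r f ->
  compact X -> compact (f @` X).
Proof.
move=> /similarity_le_continuous cf cX; apply: continuous_compact cX.
exact: continuous_subspaceT.
Qed.

(* Iterating [X `<=` \bigcup f @` X] writes a point of [X] as the image of a
   point of [X] under a word of length [n]; the same word maps [Y] into [Y]. *)
Lemma invariant_subset (F : set (plane -> plane)) (r : R) (X Y : set plane) :
  0 <= r < 1 -> (forall f, F f -> similarity_le r f) ->
  compact X -> X `<=` \bigcup_(f in F) f @` X ->
  closed Y -> Y !=set0 -> (forall f, F f -> f @` Y `<=` Y) ->
  X `<=` Y.
Proof.
move=> r01 Fr cX XF cY [y0 Yy0] FY x Xx.
have [D XD] := compact_edist_bounded y0 cX.
have approx n : forall x, X x -> exists2 y, Y y & edist x y <= r ^+ n * D.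
  elim: n => [|n IHn] {}x {}Xx; first by exists y0 => //; rewrite mul1r XD.
  have [f Ff [x' Xx' <-]] := XF _ Xx.
  have [y Yy x'y] := IHn _ Xx'.
  exists (f y); first by apply: (FY _ Ff); exists y.
  rewrite (le_trans (similarity_le_edist _ _ (Fr _ Ff))) // exprS -mulrA.
  by rewrite ler_wpM2l //; case/andP: r01.
apply: closed_edist => // e e0.
have [n ne] := geometric_lt D r01 e0.
by have [y Yy xy] := approx n _ Xx; exists y => //; exact: le_lt_trans ne.
Qed.

(** * Connectedness through chains of short steps *)

(* Any two points of [K] are joined by a chain in [K] with steps shorter than [e],
   expressed without chains. *)
Definition step_connected (e : R) (K : set plane) : Prop :=
  forall B : set plane, (K `&` B) !=set0 ->
    (forall x y, K x -> K y -> edist x y < e -> B x -> B y) -> K `<=` B.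

(** For a nonempty relatively clopen part [B] of [K], compactness yields one [e] such that no step
    shorter than [e] leaves [B]; step-connectedness at that [e] then forces [B] to be all of [K]. *)
Lemma step_connected_compact (K : set plane) : compact K ->
  (forall e, 0 < e -> step_connected e K) -> connected K.
Proof.
move=> cK Ks B [b Bb] [C oC BC] [D cD BD].
have BK : B `<=` K by rewrite BC; exact: subIsetl.
have BCE z : K z -> B z <-> C z by rewrite BC => Kz; split=> [[]|].
have BDE z : K z -> B z <-> D z by rewrite BD => Kz; split=> [[]|].
(* The fractions absorb the factor 2 of the quasi-triangle inequality: 2 (d/4 + d/8) < d. *)
have edist_half (e d : R) (x x' y : plane) :
    edist x x' < d / 4 -> edist x' y < e -> e < d / 8 -> edist x y < d.
  by have := edist_quasi_triangle x' x y; have := edist_ge0 x x'; lra.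
(* The near-covering form of compactness makes the local step size uniform. Near a point of [B]
   short steps stay in the open set [C]; near a point outside [B] there is no point of [B], since
   [D] is closed. *)
have step : \forall e \near 0^'+,
    K `<=` fun x => forall y, K y -> edist x y < e -> B x -> B y.
  move/compact_near_coveringP : cK => /(_ R); apply => x Kx.
  have [Bx|nBx] := pselect (B x).
    have : nbhs x C by apply: open_nbhs_nbhs; split => //; apply/BCE.
    move=> /nbhs_edistP[d d0 dC].
    exists ([set x' | edist x x' < d / 4], [set e | e < d / 8]) => /=.
      split; last by apply: nbhs_right_lt; rewrite divr_gt0.
      by apply/nbhs_edistP; exists (d / 4); rewrite // divr_gt0.
    move=> [x' e] [/= xx' ed] y Ky x'y _; apply/BCE => //; apply: dC.
    exact: edist_half xx' x'y ed.
  have : nbhs x (~` D).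
    apply: open_nbhs_nbhs; split; first exact: closed_openC.
    by move=> Dx; apply: nBx; apply/BDE.
  move=> /nbhs_edistP[d d0 dD].
  exists ([set x' | edist x x' < d / 4], [set e | e < d / 8]) => /=.
    split; last by apply: nbhs_right_lt; rewrite divr_gt0.
    by apply/nbhs_edistP; exists (d / 4); rewrite // divr_gt0.
  move=> [x' e] [/= xx' ed] y Ky x'y Bx'; exfalso.
  have xx'd : edist x x' < d by rewrite (lt_trans xx') //; lra.
  by apply: (dD _ xx'd); apply/BDE => //; exact: BK.
near (0 : R)^'+ => e.
have e0 : 0 < e by near: e; exact: nbhs_right_gt.
have Ke : K `<=` fun x => forall y, K y -> edist x y < e -> B x -> B y by near: e.
apply/seteqP; split=> //; apply: (Ks e e0).
  by exists b; split => //; exact: BK.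
by move=> x y Kx; exact: (Ke _ Kx).
Unshelve. all: by end_near. Qed.

(** * Simple closed curves with a point removed *)

(** If [b] is off the curve, nothing is removed. If [b] is [f 0], the image of the open interval
    remains. Otherwise two half-open arcs remain, and they share the point [f 0 = f 1]. *)
Lemma curve_minus_point_connected (T : topologicalType) (f : R -> T) :
  {within `[0, 1], continuous f} -> f 0 = f 1 -> {in `[0, 1[ &, injective f} ->
  forall b, connected (f @` `[0, 1] `\ b).
Proof.
move=> cf f01 injf b.
have arc (i : interval R) : [set` i] `<=` `[0, 1] -> connected (f @` [set` i]).
  move=> i01; apply: connected_continuous_connected.
    by apply/connected_intervalP; exact: interval_is_interval.
  exact: continuous_subspaceW i01 cf.
have [[t t01 ft]|nb] := pselect ((f @` `[0, 1[) b); last first.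
  rewrite (_ : _ `\ b = f @` `[0, 1]); first exact: arc.
  apply/seteqP; split=> z; first by case.
  move=> Cz; split => // zb; apply: nb; move: Cz => [t /= t01 ftz].
  have [t1|t1] := eqVneq t 1.
    by exists 0; [rewrite /= in_itv /= lexx ltr01|rewrite f01 -t1 ftz].
  exists t; last by rewrite ftz.
  by move: t01; rewrite /= !in_itv /= => /andP[-> ?]; rewrite lt_neqAle t1.
move: t01; rewrite /= in_itv /= => /andP[t0 t1].
have ne u : 0 <= u < 1 -> u != t -> f u <> b.
  move=> u01 ut fub; move/eqP: ut; apply; apply: injf; rewrite ?in_itv /= ?u01 ?t0 ?t1 //.
  by rewrite fub ft.
have [t00|tn0] := eqVneq t 0.
  rewrite (_ : _ `\ b = f @` `]0, 1[).
    by apply: arc => u; rewrite /= !in_itv /= => /andP[/ltW-> /ltW].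
  apply/seteqP; split => z.
    move=> [[u /=]]; rewrite in_itv /= => /andP[u0 u1] <- fub.
    exists u => //=; rewrite in_itv /= !lt_neqAle u0 u1 !andbT eq_sym.
    apply/andP; split; apply/eqP => ueq; apply: fub.
      by rewrite -ft t00 ueq.
    by rewrite -ft t00 ueq f01.
  move=> [u /=]; rewrite in_itv /= => /andP[u0 u1] <-; split.
    by exists u; rewrite //= in_itv /= !ltW.
  by apply: ne; rewrite ?(ltW u0) // t00 gt_eqF.
have {tn0}t0' : 0 < t by rewrite lt_neqAle eq_sym tn0.
rewrite (_ : _ `\ b = f @` `[0, t[ `|` f @` `]t, 1]).
  apply: connectedU.
  - exists (f 0); split; first by exists 0; rewrite //= in_itv /= lexx.
    by exists 1; rewrite //= in_itv /= t1 lexx.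
  - by apply: arc => u; rewrite /= !in_itv /= => /andP[-> /lt_trans/(_ t1)/ltW].
  - by apply: arc => u; rewrite /= !in_itv /= => /andP[/(lt_trans t0')/ltW-> ->].
apply/seteqP; split => z.
  move=> [[u /=]]; rewrite in_itv /= => /andP[u0 u1] <- fub.
  have [ut|ut|ut] := ltgtP u t.
  - by left; exists u; rewrite //= in_itv /= u0.
  - by right; exists u; rewrite //= in_itv /= ut.
  - by exfalso; apply: fub; rewrite ut.
case=> -[u /=]; rewrite in_itv /= => /andP[u0 u1] <-.
  split; first by exists u; rewrite //= in_itv /= u0 ltW // (lt_trans u1).
  by apply: ne; rewrite ?u0 ?(lt_trans u1) // lt_eqF.
split; first by exists u; rewrite //= in_itv /= u1 andbT ltW // (lt_trans t0').
have [->|un1] := eqVneq u 1.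
  by rewrite -f01; apply: ne; rewrite ?lexx ?ltr01 // lt_eqF.
by apply: ne; rewrite ?gt_eqF // (ltW (lt_trans t0' u0)) lt_neqAle un1.
Qed.

(** * Self-similar sets whose pieces form a star around the piece of [f0] *)

Section Hub.
Context (F : set (plane -> plane)) (f0 : plane -> plane) (r : R).
Context (K : set plane).
Context (finF : finite_set F) (Ff0 : F f0) (r01 : 0 <= r < 1).
Context (Fr : forall f, F f -> similarity_le r f).
Context (K0 : K !=set0) (cK : compact K).
Context (KF : K = \bigcup_(f in F) f @` K).
Context (hub : forall f, F f -> f <> f0 -> exists b, f0 @` K `&` f @` K = [set b]).
Context (disj : forall f g, F f -> F g -> f <> f0 -> g <> f0 -> f <> g ->
  f @` K `&` g @` K = set0).

Lemma piece_sub f : F f -> f @` K `<=` K.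
Proof. by move=> Ff; rewrite [X in _ `<=` X]KF => z fz; exists f. Qed.

Lemma piece_compact f : F f -> compact (f @` K).
Proof. by move=> Ff; apply: similarity_le_compact cK; exact: Fr. Qed.

Lemma hub_meet f : F f -> (f0 @` K `&` f @` K) !=set0.
Proof.
move=> Ff; have [->|ff0] := pselect (f = f0).
  by rewrite setIid; have [z Kz] := K0; exists (f0 z), z.
by have [b ->] := hub Ff ff0; exists b.
Qed.

(** Each piece inherits the property at scale [r * e] by pulling [B] back along its map. A set [B]
    that contains one piece then reaches the central piece, and from there every other, through
    shared points. *)
Lemma step_connectedS e : step_connected e K -> step_connected (r * e) K.
Proof.
move=> Ke B [b [Kb Bb]] Bstep.
have piece f : F f -> (f @` K `&` B) !=set0 -> f @` K `<=` B.
  move=> Ff [_ [[z Kz <-] Bfz]] _ [w Kw <-].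
  apply: (Ke (f @^-1` B)) => //; first by exists z.
  move=> x y Kx Ky xy /=; apply: Bstep; try by apply: (piece_sub Ff); exists x.
    by apply: (piece_sub Ff); exists y.
  have [s /andP[s0 sr] ->] := Fr Ff.
  rewrite (le_lt_trans (ler_wpM2r (edist_ge0 _ _) sr)) // ltr_pM2l //.
  exact: lt_le_trans sr.
have [f Ff fb] : (\bigcup_(f in F) f @` K) b by rewrite -KF.
have fB : f @` K `<=` B by apply: piece => //; exists b.
have f0B : f0 @` K `<=` B.
  have [z [f0z fz]] := hub_meet Ff.
  by apply: piece => //; exists z; split => //; exact: fB.
rewrite KF => x [g Fg gx]; have [z [f0z gz]] := hub_meet Fg.
by apply: (piece g) gx => //; exists z; split => //; exact: f0B.
Qed.

Lemma attractor_connected : connected K.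
Proof.
apply: step_connected_compact => // e e0.
have [k Kk] := K0.
have [D KD] := compact_edist_bounded k cK.
(* Two points within [D] of [k] are at distance at most 4 D by the quasi-triangle inequality; adding
   1 makes the bound strict, so at scale [M] a single step suffices. *)
pose M := 4 * `|D| + 1.
have KM x y : K x -> K y -> edist x y < M.
  move=> /KD xk /KD yk; by have := edist_quasi_triangle k x y; rewrite (edistC k y) /M; have := ler_norm D; lra.
have iter n : step_connected (r ^+ n * M) K.
  elim: n => [|n IHn]; last by rewrite exprS -mulrA; exact: step_connectedS.
  rewrite mul1r => B [b [Kb Bb]] Bs x Kx; apply: (Bs b) => //; exact: KM.
have [n ne] := geometric_lt M r01 e0.
move=> B KB Bs; apply: (iter n) => // x y Kx Ky xy; apply: Bs => //.
exact: lt_trans ne.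
Qed.

(** The members are the images of [K] under all words of length [n]: connected because [K] is, and
    of diameter at most [r ^+ n] times a bound for that of [K]. *)
Lemma small_connected_cover (e : R) : 0 < e -> exists L : set (set plane),
  [/\ finite_set L, K = \bigcup_(P in L) P &
      forall P, L P -> [/\ compact P, connected P &
        forall x y, P x -> P y -> edist x y < e]].
Proof.
pose cover (d : R) := exists L : set (set plane),
  [/\ finite_set L, K = \bigcup_(P in L) P &
      forall P, L P -> [/\ compact P, connected P &
        forall x y, P x -> P y -> edist x y <= d]].
move=> e0; have [k Kk] := K0.
have [D KD] := compact_edist_bounded k cK.
have iter n : cover (r ^+ n * (4 * D)).
  elim: n => [|n [L [finL KL Ld]]].
    exists [set K]; split; [exact: finite_set1|by rewrite bigcup_set1|].
    move=> _ ->; split => //; first exact: attractor_connected.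
    move=> x y /KD xk /KD yk; rewrite mul1r.
    by have := edist_quasi_triangle k x y; rewrite (edistC k y); lra.
  exists [set fP.1 @` fP.2 | fP in F `*` L]; split.
  - by apply: finite_image; exact: finite_setX.
  - apply/seteqP; split => z.
      rewrite {1}KF => -[f Ff [y]]; rewrite {1}KL => -[P LP Py] <-.
      by exists (f @` P); [exists (f, P)|exists y].
    move=> [_ [[f P] /= [Ff LP] <-]] [y Py <-].
    by apply: (piece_sub Ff); exists y => //; rewrite KL; exists P.
  - move=> _ [[f P] /= [Ff LP] <-]; have [cP conP Pd] := Ld _ LP; split.
    + exact: similarity_le_compact (Fr Ff) cP.
    + apply: connected_continuous_connected => //; apply: continuous_subspaceT.
      exact: similarity_le_continuous (Fr Ff).
    + move=> _ _ [x Px <-] [y Py <-].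
      rewrite (le_trans (similarity_le_edist _ _ (Fr Ff))) // exprS -mulrA.
      by rewrite ler_wpM2l ?Pd //; case/andP: r01.
have [n ne] := geometric_lt (4 * D) r01 e0.
have [L [finL KL Ln]] := iter n; exists L; split => // P /Ln[cP conP Pn].
by split => // x y Px Py; exact: le_lt_trans (Pn _ _ Px Py) ne.
Qed.

(** The neighbourhood is the component of [x] in the part of [K] inside the interior of [U]; the
    small connected cover shows that it is open in [K]. *)
Lemma attractor_locally_connected : locally_connected K.
Proof.
move=> x Kx U xU; set V := connected_component (K `&` U°) x.
have KUx : (K `&` U°) x by [].
exists V; split.
- exact: connected_component_refl.
- by move=> z /connected_component_sub[_ /interior_subset].
- exact: component_connected.
(* Taking the union of all open sets with trace inside [V] lets openness be checked one point at a
   time. *)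
exists (\bigcup_(W in [set W | open W /\ K `&` W `<=` V]) W).
  by apply: bigcup_open => W [].
apply/seteqP; split=> [y Vy|z [Kz [W [_ WV] Wz]]]; last exact: WV.
have [Ky Uy] := connected_component_sub Vy.
split => //.
have /nbhs_edistP[d d0 dU] : nbhs y U° by apply: open_nbhs_nbhs; split => //; exact: open_interior.
have [L [finL KL Ld]] := small_connected_cover d0.
(* Discarding the finitely many closed members that miss [y] leaves an open set. Its points in [K]
   lie in members through [y], which are connected and small enough to stay in the interior of [U],
   hence in [V]. *)
exists (~` \bigcup_(P in [set P | L P /\ ~ P y]) P); last first.
  by move=> [P [_ nPy]].
split.
  apply: closed_openC; apply: closed_bigcup.
    by apply: sub_finite_set finL => P [].
  by move=> P [/Ld[cP _ _] _]; apply: compact_closed => //; exact: norm_hausdorff.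
move=> z [Kz nz]; have [P LP Pz] : (\bigcup_(P in L) P) z by rewrite -KL.
have Py : P y by apply: contrapT => nPy; apply: nz; exists P.
apply: connected_component_trans Vy _; have [_ conP Pd] := Ld _ LP.
apply: (connected_component_max Py) => // w Pw; split.
  by rewrite KL; exists P.
exact: dU (Pd _ _ Py Pw).
Qed.

(** If the curve has a point [c] outside the central piece, [c] lies in some outer piece. Removing
    the gluing point [b] separates that piece from the rest of [K] but leaves the curve connected,
    so the curve stays on the side of [c]. *)
Lemma curve_piece (f : R -> plane) : {within `[0, 1], continuous f} ->
  f 0 = f 1 -> {in `[0, 1[ &, injective f} -> f @` `[0, 1] `<=` K ->
  exists2 g, F g & f @` `[0, 1] `<=` g @` K.
Proof.
move=> cf f01 injf fK.
have [Cf0|] := pselect (f @` `[0, 1] `<=` f0 @` K); first by exists f0.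
move=> /existsNP[c /not_implyP[Cc nf0c]].
have [g Fg gc] : (\bigcup_(f in F) f @` K) c by rewrite -KF; exact: fK.
have gf0 : g <> f0 by move=> gf0; apply: nf0c; rewrite -gf0.
have [b gb] := hub Fg gf0.
have [f0b gKb] : (f0 @` K `&` g @` K) b by rewrite gb.
pose E1 := g @` K `\ b.
pose E2 := (\bigcup_(h in [set h | F h /\ h <> g]) h @` K) `\ b.
have closed_piece h : F h -> closed (h @` K).
  by move=> Fh; apply: compact_closed (piece_compact Fh); exact: norm_hausdorff.
have gh_b h z : F h -> h <> g -> (g @` K) z -> (h @` K) z -> z = b.
  move=> Fh hg gz hz; have [hf0|hf0] := pselect (h = f0).
    by have : [set b] z by rewrite -gb -hf0.
  have : (g @` K `&` h @` K) z by [].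
  by rewrite disj // => gh; apply: hg.
have sepE : separated E1 E2.
  split; apply/seteqP; split => // z.
    move=> [/(closureS (@subDsetl _ _ _))]; rewrite -(closure_id _).1; last exact: closed_piece.
    by move=> gz [[h [Fh hg] hz]]; apply; exact: gh_b hz.
  move=> [[gz zb]] /(closureS (@subDsetl _ _ _)); rewrite -(closure_id _).1.
    by move=> [h [Fh hg] hz]; apply: zb; exact: gh_b hz.
  apply: closed_bigcup; first by apply: sub_finite_set finF => h [].
  by move=> h [Fh _]; exact: closed_piece.
exists g => //.
have : f @` `[0, 1] `\ b `<=` E1 `|` E2.
  move=> z [Cz zb]; have [h Fh hz] : (\bigcup_(f in F) f @` K) z by rewrite -KF; exact: fK.
  have [hg|hg] := pselect (h = g); first by left; split => //; rewrite -hg.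
  by right; split => //; exists h.
move/(connected_subset sepE)/(_ (@curve_minus_point_connected _ f cf f01 injf b)).
have cb : c <> b by move=> cb; apply: nf0c; rewrite cb.
case=> [CE1 z Cz|CE2].
  have [->//|zb] := pselect (z = b).
  by have [] := CE1 z (conj Cz zb).
have E2c : E2 c by exact: CE2.
have E12c : (E1 `&` E2) c by [].
by rewrite separated_disjoint in E12c.
Qed.

Lemma attractor_no_curve : ~ exists2 C, simple_closed_curve R C & C `<=` K.
Proof.
move=> [_ [f [cf f01 injf ->]] fK].
have [k Kk] := K0; have [D KD] := compact_edist_bounded k cK.
have i0 : (0 : R) \in `[0, 1] by rewrite in_itv /= lexx ler01.
have ih : (2^-1 : R) \in `[0, 1] by rewrite in_itv /=; apply/andP; split; lra.
(* The bound is proved for all closed curves in [K] at once, since the induction step replaces [f]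
   by its pull-back [h] along [g]. *)
have small n : forall f : R -> plane, {within `[0, 1], continuous f} ->
    f 0 = f 1 -> {in `[0, 1[ &, injective f} -> f @` `[0, 1] `<=` K ->
    edist (f 0) (f (2^-1)) <= r ^+ n * (4 * D).
  elim: n => [|n IHn] {cf f01 injf fK} {}f cf f01 injf fK.
    rewrite mul1r; have /KD f0k : K (f 0) by apply: fK; exists 0.
    have /KD fhk : K (f (2^-1)) by apply: fK; exists (2^-1).
    have := edist_quasi_triangle k (f 0) (f (2^-1)).
    by rewrite (edistC k); lra.
  have [g Fg fg] := curve_piece cf f01 injf fK.
  (* Outside the unit interval [h] takes the dummy value [k]. *)
  have /choice[h hP] (t : R) : exists y, t \in `[0, 1] -> K y /\ g y = f t.
    have [t01|t01] := boolP (t \in `[0, 1]); last by exists k.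
    by have [y Ky gy] := fg (f t) (ex_intro2 _ _ t t01 erefl); exists y.
  have ginj := similarity_le_inj (Fr Fg).
  have [s /andP[s0 _] gs] := Fr Fg.
  have i1 : (1 : R) \in `[0, 1] by rewrite in_itv /= lexx ler01.
  have hf t : t \in `[0, 1] -> g (h t) = f t by move=> /hP[].
  rewrite -!hf // (le_trans (similarity_le_edist _ _ (Fr Fg))) // exprS -mulrA.
  rewrite ler_wpM2l //; first by case/andP: r01.
  apply: IHn.
  (* Since [g] scales distances by exactly [s], an [e]-ball for [h] corresponds to an [s * e]-ball
     for [f]. *)
  - apply/subspace_continuousP => t t01 U /nbhs_edistP[e e0 eU].
    have /subspace_continuousP/(_ t t01) := cf.
    move=> /(_ [set z | edist (f t) z < s * e]) ftU.
    have {}ftU : \forall u \near t, u \in `[0, 1] -> edist (f t) (f u) < s * e.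
      by apply: ftU; apply/nbhs_edistP; exists (s * e) => //; rewrite mulr_gt0.
    suff : \forall u \near t, u \in `[0, 1] -> U (h u) by [].
    apply: filterS ftU => u ftu u01; apply: eU; move: (ftu u01).
    by rewrite -(hf t t01) -(hf u u01) gs ltr_pM2l.
  - by apply: ginj; rewrite !hf.
  - move=> t u t01 u01 htu; apply: injf => //.
    have sub v : v \in `[0, 1[ -> v \in `[(0 : R), 1].
      by rewrite !in_itv /= => /andP[-> /ltW].
    by rewrite -!hf ?htu //; exact: sub.
  - by move=> _ [t t01 <-]; have [] := hP t t01.
(* The bounds force the points at parameters 0 and 1/2 to coincide, against injectivity. *)
have : f 0 <> f (2^-1).
  move=> /injf; rewrite !in_itv /= => h; have : (0 : R) = 2^-1 by apply: h; apply/andP; split; lra.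
  lra.
apply; apply: edist_eq0; apply/eqP; rewrite eq_le edist_ge0 andbT leNgt.
apply/negP => e0; have [n] := geometric_lt (4 * D) r01 e0.
by rewrite ltNge small.
Qed.

Lemma hub_attractor_dendrite : dendrite K.
Proof.
split => //; [exact: attractor_connected|exact: attractor_locally_connected|].
exact: attractor_no_curve.
Qed.
End Hub.
End StarAttractor.

(** * Barycentric coordinates in the equilateral triangle *)

Section Triangle.
Context {R : realType}.
Local Notation plane := (R * R)%type.
Local Notation sqrt3 := (Num.sqrt 3 : R).
Implicit Types (z w : plane) (p : R).

Lemma sqrt3_gt0 : 0 < sqrt3.
Proof. by rewrite sqrtr_gt0. Qed.

Lemma sqrt3_sqr : sqrt3 ^+ 2 = 3.
Proof. by rewrite sqr_sqrtr. Qed.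

(* Barycentric coordinates with respect to [A1], [A2], [A3]. *)
Definition bary1 (z : plane) : R := 1 - z.1 - z.2 / sqrt3.
Definition bary2 (z : plane) : R := z.1 - z.2 / sqrt3.
Definition bary3 (z : plane) : R := 2 * z.2 / sqrt3.

Lemma bary_sum z : bary1 z + bary2 z + bary3 z = 1.
Proof. by rewrite /bary1 /bary2 /bary3; ring. Qed.

Lemma fst_bary z : z.1 = bary2 z + bary3 z / 2.
Proof. by rewrite /bary2 /bary3; field; rewrite gt_eqF ?sqrt3_gt0. Qed.

Lemma snd_bary z : z.2 = sqrt3 / 2 * bary3 z.
Proof. by rewrite /bary3; field; rewrite gt_eqF ?sqrt3_gt0. Qed.

Lemma bary_inj z w : bary2 z = bary2 w -> bary3 z = bary3 w -> z = w.
Proof.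
move=> e2 e3; apply: injective_projections.
  by rewrite !fst_bary e2 e3.
by rewrite !snd_bary e3.
Qed.

Lemma baryA1 : [/\ bary1 A1 = 1, bary2 A1 = 0 & bary3 A1 = 0].
Proof. by rewrite /bary1 /bary2 /bary3 /=; split; ring. Qed.

Lemma baryA2 : [/\ bary1 A2 = 0, bary2 A2 = 1 & bary3 A2 = 0].
Proof. by rewrite /bary1 /bary2 /bary3 /=; split; ring. Qed.

Lemma baryA3 : [/\ bary1 A3 = 0, bary2 A3 = 0 & bary3 A3 = 1].
Proof.
by rewrite /bary1 /bary2 /bary3 /=; split; field; rewrite gt_eqF ?sqrt3_gt0.
Qed.

Lemma baryS1 p z : [/\ bary1 (S1 p z) = p * bary1 z + (1 - p),
  bary2 (S1 p z) = p * bary2 z & bary3 (S1 p z) = p * bary3 z].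
Proof. by rewrite /bary1 /bary2 /bary3 /S1 /= /GRing.scale /=; split; ring. Qed.

Lemma baryS2 p z : [/\ bary1 (S2 p z) = p * bary1 z,
  bary2 (S2 p z) = p * bary2 z + (1 - p) & bary3 (S2 p z) = p * bary3 z].
Proof. by rewrite /bary1 /bary2 /bary3 /S2 /= /GRing.scale /=; split; ring. Qed.

Lemma baryS3 p z : [/\ bary1 (S3 p z) = p * bary1 z,
  bary2 (S3 p z) = p * bary2 z & bary3 (S3 p z) = p * bary3 z + (1 - p)].
Proof.
rewrite /bary1 /bary2 /bary3 /S3 /= /GRing.scale /=.
by split; field; rewrite gt_eqF ?sqrt3_gt0.
Qed.

Definition triangle : set plane :=
  [set z | [/\ 0 <= bary1 z, 0 <= bary2 z & 0 <= bary3 z]].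

(** The edges from [A1] to [A2] and to [A3] are unit vectors with inner product 1/2, whence the
    mixed term. *)
Lemma edist_sqr_bary z w : edist z w ^+ 2 =
  (bary2 z - bary2 w) ^+ 2 + (bary2 z - bary2 w) * (bary3 z - bary3 w)
  + (bary3 z - bary3 w) ^+ 2.
Proof.
rewrite edist_sqr !fst_bary !snd_bary -mulrBr exprMn expr_div_n sqrt3_sqr.
by field.
Qed.

(** Four times the quadratic form of the distance dominates the square of each coordinate
    difference. This continuity estimate gives closedness of the triangle. *)
Lemma bary_lipschitz z w : [/\ bary1 z - bary1 w <= 2 * edist z w,
  bary2 z - bary2 w <= 2 * edist z w & bary3 z - bary3 w <= 2 * edist z w].
Proof.
have e0 := edist_ge0 z w; have es := edist_sqr_bary z w.
have sz := bary_sum z; have sw := bary_sum w.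
have bound t : t ^+ 2 <= (2 * edist z w) ^+ 2 -> t <= 2 * edist z w.
  have [t0|t0 h] := leP t 0; first by rewrite (le_trans t0) // mulr_ge0.
  by rewrite -ler_sqr ?nnegrE ?mulr_ge0 // ltW.
pose v := bary2 z - bary2 w; pose u := bary3 z - bary3 w.
have uE : u = bary3 z - bary3 w by []. have vE : v = bary2 z - bary2 w by [].
rewrite -vE -uE in es *.
have -> : bary1 z - bary1 w = - (v + u) by lra.
have := sqr_ge0 (v + 2 * u); have := sqr_ge0 (u + 2 * v); have := sqr_ge0 (u - v).
by split; apply: bound; rewrite exprMn es; nra.
Qed.

Lemma closed_triangle : closed triangle.
Proof.
move=> z zT.
have near e : 0 < e -> exists2 w, triangle w & edist z w < e.
  move=> e0; have [|w [Tw zw]] := zT [set w | edist z w < e]; last by exists w.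
  by apply/nbhs_edistP; exists e.
have coord (l : plane -> R) : (forall w, l w - l z <= 2 * edist z w) ->
    (forall w, triangle w -> 0 <= l w) -> 0 <= l z.
  move=> lz lT; rewrite leNgt; apply/negP => lz0.
  have [|w Tw zw] := near (- l z / 2); first by rewrite divr_gt0 // oppr_gt0.
  by have := lz w; have := lT w Tw; lra.
split; apply: coord => w; try (by case);
  by rewrite edistC; have [] := bary_lipschitz w z.
Qed.

(* The distances to the three vertices determine a point of the plane, so a
   similarity acts on barycentric coordinates by the images of the vertices. *)
Lemma similarity_bary (S0 : plane -> plane) z : similarity S0 ->
  S0 z = bary1 z *: S0 A1 + bary2 z *: S0 A2 + bary3 z *: S0 A3.
Proof.
move=> [r r0 S0r].
have dist u v : ((S0 u).1 - (S0 v).1) ^+ 2 + ((S0 u).2 - (S0 v).2) ^+ 2 = r ^+ 2 *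
    ((bary2 u - bary2 v) ^+ 2 + (bary2 u - bary2 v) * (bary3 u - bary3 v)
     + (bary3 u - bary3 v) ^+ 2).
  by rewrite -edist_sqr -edist_sqr_bary S0r exprMn.
have [_ a12 a13] := baryA1; have [_ a22 a23] := baryA2.
have [_ a32 a33] := baryA3.
move: (dist A1 A2) (dist A1 A3) (dist A2 A3) (dist z A1) (dist z A2) (dist z A3).
rewrite a12 a13 a22 a23 a32 a33 /=.
move: (S0 A1) (S0 A2) (S0 A3) (S0 z) => -[x1 y1] [x2 y2] [x3 y3] [x y] /=.
rewrite /GRing.scale /=.
have -> : bary1 z = 1 - bary2 z - bary3 z by have := bary_sum z; lra.
have : 0 < r ^+ 2 by rewrite exprn_gt0.
move: (bary2 z) (bary3 z) (r ^+ 2) => b c q q0.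
move=> d12 d13 d23 d1 d2 d3.
(* [(u2, v2)] and [(u3, v3)] are the edges of the image triangle, and [(du, dv)] is the error to be
   shown zero. Polarizing the distance equations makes it orthogonal to both edges. *)
pose u2 := x2 - x1; pose v2 := y2 - y1; pose u3 := x3 - x1; pose v3 := y3 - y1.
pose du := x - ((1 - b - c) * x1 + b * x2 + c * x3).
pose dv := y - ((1 - b - c) * y1 + b * y2 + c * y3).
have e22 : u2 ^+ 2 + v2 ^+ 2 = q by rewrite /u2 /v2; lra.
have e33 : u3 ^+ 2 + v3 ^+ 2 = q by rewrite /u3 /v3; lra.
have e23 : u2 * u3 + v2 * v3 = q / 2 by rewrite /u2 /v2 /u3 /v3; lra.
have w2 : (x - x1) * u2 + (y - y1) * v2 = q * (b + c / 2).
  by rewrite /u2 /v2; lra.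
have w3 : (x - x1) * u3 + (y - y1) * v3 = q * (b / 2 + c).
  by rewrite /u3 /v3; lra.
have d2' : du * u2 + dv * v2 = 0.
  have -> : du * u2 + dv * v2 = (x - x1) * u2 + (y - y1) * v2
      - b * (u2 ^+ 2 + v2 ^+ 2) - c * (u2 * u3 + v2 * v3).
    by rewrite /du /dv /u2 /v2 /u3 /v3; ring.
  by rewrite w2 e22 e23; lra.
have d3' : du * u3 + dv * v3 = 0.
  have -> : du * u3 + dv * v3 = (x - x1) * u3 + (y - y1) * v3
      - b * (u2 * u3 + v2 * v3) - c * (u3 ^+ 2 + v3 ^+ 2).
    by rewrite /du /dv /u2 /v2 /u3 /v3; ring.
  by rewrite w3 e33 e23; lra.
(* Lagrange's identity gives the Gram determinant of the edges; it is nonzero, so they are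
   independent. *)
have det : (u2 * v3 - u3 * v2) ^+ 2 = 3 / 4 * q ^+ 2.
  have -> : (u2 * v3 - u3 * v2) ^+ 2 = (u2 ^+ 2 + v2 ^+ 2) * (u3 ^+ 2 + v3 ^+ 2)
     - (u2 * u3 + v2 * v3) ^+ 2 by ring.
  by rewrite e22 e33 e23; field.
have det0 : u2 * v3 - u3 * v2 != 0.
  by rewrite -sqrf_eq0 det mulf_neq0 ?sqrf_eq0 ?gt_eqF // divr_gt0.
have du0 : du = 0.
  apply: (mulIf det0); rewrite mul0r.
  have -> : du * (u2 * v3 - u3 * v2) = v3 * (du * u2 + dv * v2) - v2 * (du * u3 + dv * v3) by ring.
  by rewrite d2' d3'; ring.
have dv0 : dv = 0.
  apply: (mulIf det0); rewrite mul0r.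
  have -> : dv * (u2 * v3 - u3 * v2) = u2 * (du * u3 + dv * v3) - u3 * (du * u2 + dv * v2) by ring.
  by rewrite d2' d3'; ring.
by congr (_, _); apply/eqP; rewrite -subr_eq0; apply/eqP.
Qed.

Lemma bary_comb z (P Q T : plane) : let w := bary1 z *: P + bary2 z *: Q + bary3 z *: T in
  [/\ bary1 w = bary1 z * bary1 P + bary2 z * bary1 Q + bary3 z * bary1 T,
      bary2 w = bary1 z * bary2 P + bary2 z * bary2 Q + bary3 z * bary2 T &
      bary3 w = bary1 z * bary3 P + bary2 z * bary3 Q + bary3 z * bary3 T].
Proof.
have -> : bary1 z = 1 - bary2 z - bary3 z by have := bary_sum z; lra.
move: (bary2 z) (bary3 z) => b c.
case: P Q T => [x1 y1] [x2 y2] [x3 y3].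
by rewrite /bary1 /bary2 /bary3 /= /GRing.scale /=; split; ring.
Qed.

(** * Ratios of the maps, convex combinations and sides of the triangle *)

Lemma edist_homothety (f : plane -> plane) p : 0 <= p ->
  (forall z w, f z - f w = p *: (z - w)) ->
  forall z w, edist (f z) (f w) = p * edist z w.
Proof.
move=> p0 fp z w; have := fp z w; rewrite /Defs.edist.
move: (f z) (f w); case: z w => [u v] [u' v'] [x y] [x' y'] [/= -> ->].
rewrite /GRing.scale /= !exprMn -mulrDr sqrtrM ?sqr_ge0 //.
by rewrite sqrtr_sqr ger0_norm.
Qed.

Lemma edist_S1 (p : R) z w : 0 <= p -> edist (S1 p z) (S1 p w) = p * edist z w.
Proof. by move=> p0; apply: edist_homothety => // {}z {}w; rewrite scalerBr. Qed.

Lemma edist_S2 (p : R) z w : 0 <= p -> edist (S2 p z) (S2 p w) = p * edist z w.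
Proof.
move=> p0; apply: edist_homothety => // {}z {}w.
by rewrite /S2 scalerBr opprD addrACA subrr addr0 opprB addrA subrK.
Qed.

Lemma edist_S3 (p : R) z w : 0 <= p -> edist (S3 p z) (S3 p w) = p * edist z w.
Proof.
move=> p0; apply: edist_homothety => // {}z {}w.
by rewrite /S3 scalerBr opprD addrACA subrr addr0 opprB addrA subrK.
Qed.

Lemma attractor_bigcup (fs : seq (plane -> plane)) K : is_attractor fs K ->
  K = \bigcup_(f in [set` fs]) f @` K.
Proof. by move=> [_ _ {1}->]; rewrite bigcup_seq. Qed.

(** Substituting a = 1 - b - c gives b (m - u) + c (m - v) <= 0 with both terms nonnegative. It
    identifies the gluing points: an affine function is maximal only at its top vertex. *)
Lemma convex_comb_max (a b c m u v : R) : 0 <= b -> 0 <= c ->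
  a + b + c = 1 -> u < m -> v < m -> m <= a * m + b * u + c * v ->
  b = 0 /\ c = 0.
Proof.
move=> b0 c0 abc um vm h.
have ea : a = 1 - b - c by lra.
have hb : 0 <= b * (m - u) by rewrite mulr_ge0 // subr_ge0 ltW.
have hc : 0 <= c * (m - v) by rewrite mulr_ge0 // subr_ge0 ltW.
have : b * (m - u) = 0 by rewrite ea in h; lra.
have : c * (m - v) = 0 by rewrite ea in h; lra.
move=> /eqP; rewrite mulf_eq0 subr_eq0 (gt_eqF vm) orbF => /eqP ->.
by move=> /eqP; rewrite mulf_eq0 subr_eq0 (gt_eqF um) orbF => /eqP ->.
Qed.

Lemma bary1_segment23 z : segment A2 A3 z -> bary1 z = 0.
Proof.
move=> [t _ <-]; rewrite /bary1 /= /GRing.scale /=.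
by field; rewrite gt_eqF ?sqrt3_gt0.
Qed.

Lemma bary2_segment13 z : segment A1 A3 z -> bary2 z = 0.
Proof.
move=> [t _ <-]; rewrite /bary2 /= /GRing.scale /=.
by field; rewrite gt_eqF ?sqrt3_gt0.
Qed.

Lemma bary3_segment12 z : segment A1 A2 z -> bary3 z = 0.
Proof.
by move=> [t _ <-]; rewrite /bary3 /= /GRing.scale /=; ring.
Qed.

End Triangle.

(** * The star structure of the attractor *)

Theorem theorem1 (R : realType) (p1 p2 p3 : R) (B1 B2 B3 : (R * R)%type)
    (S0 : (R * R)%type -> (R * R)%type) (K : set (R * R)%type) :
  admissible p1 p2 p3 B1 B2 B3 ->
  similarity S0 -> S0 A1 = B1 -> S0 A2 = B2 -> S0 A3 = B3 ->
  is_attractor [:: S1 p1; S2 p2; S3 p3; S0] K ->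
  dendrite K.
Proof.
move=> [[p1_gt0 p2_gt0 p3_gt0] p_lt1 _ [K' attrK' [K'B1 K'B2 K'B3]]].
move=> simS0 S0A1 S0A2 S0A3 attrK.
have KF := attractor_bigcup attrK; have K'F := attractor_bigcup attrK'.
have [K0 cK _] := attrK; have [K'0 cK' _] := attrK'.
set F := [set` [:: S1 p1; S2 p2; S3 p3; S0]] in KF.
set F' := [set` [:: S1 p1; S2 p2; S3 p3]] in K'F.
have FP f : F f -> [\/ f = S1 p1, f = S2 p2, f = S3 p3 | f = S0].
  rewrite /F /= !inE => /or4P[] /eqP ->; [exact: Or41|exact: Or42|exact: Or43|exact: Or44].
have F1 : F (S1 p1) by rewrite /F /= !inE eqxx.
have F2 : F (S2 p2) by rewrite /F /= !inE eqxx orbT.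
have F3 : F (S3 p3) by rewrite /F /= !inE eqxx !orbT.
have F0 : F S0 by rewrite /F /= !inE eqxx !orbT.
have F'F f : F' f -> F f.
  by rewrite /F' /F /= !inE => /or3P[] ->; rewrite ?orbT.
have F'P f : F' f -> [\/ f = S1 p1, f = S2 p2 | f = S3 p3].
  rewrite /F' /= !inE => /or3P[] /eqP ->; [exact: Or31|exact: Or32|exact: Or33].
have [a11 a12 a13] := @baryA1 R; have [a21 a22 a23] := @baryA2 R.
have [a31 a32 a33] := @baryA3 R.
have S0E z : [/\ bary1 (S0 z) = bary1 z * bary1 B1 + bary2 z * bary1 B2 + bary3 z * bary1 B3,
      bary2 (S0 z) = bary1 z * bary2 B1 + bary2 z * bary2 B2 + bary3 z * bary2 B3 &
      bary3 (S0 z) = bary1 z * bary3 B1 + bary2 z * bary3 B2 + bary3 z * bary3 B3].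
  by rewrite (similarity_bary z simS0) S0A1 S0A2 S0A3; exact: bary_comb.
have T0 : @triangle R !=set0 by exists A1; rewrite /triangle /= a11 a12 a13.
have triangleS f : F' f -> f @` @triangle R `<=` @triangle R.
  move=> /F'P[] -> _ [z [z1 z2 z3] <-]; rewrite /triangle /=.
  - by have [-> -> ->] := baryS1 p1 z; split; nra.
  - by have [-> -> ->] := baryS2 p2 z; split; nra.
  - by have [-> -> ->] := baryS3 p3 z; split; nra.
have small_maps r : p1 <= r -> p2 <= r -> p3 <= r -> forall f, F' f -> similarity_le r f.
  move=> p1r p2r p3r f /F'P[] ->.
  - by exists p1 => [|z w]; [rewrite p1_gt0|rewrite edist_S1 // ltW].
  - by exists p2 => [|z w]; [rewrite p2_gt0|rewrite edist_S2 // ltW].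
  - by exists p3 => [|z w]; [rewrite p3_gt0|rewrite edist_S3 // ltW].
have K'T : K' `<=` @triangle R.
  apply: (invariant_subset (F := F') (r := p1 + p2 + p3)) => //.
  - by apply/andP; split; lra.
  - by apply: small_maps; lra.
  - by rewrite {1}K'F.
  - exact: closed_triangle.
(* The first coordinate vanishes on the side opposite [A1], stays 0 under [S2], and becomes 1 - p1
   under [S1]; the other two cases are cyclic. *)
have bary1B1 : bary1 B1 = 1 - p1.
  have [_ [w /bary1_segment23 w0 <-]] := K'B1.
  by have [-> _ _] := baryS1 p1 (S2 p2 w); have [-> _ _] := baryS2 p2 w; rewrite w0; ring.
have bary2B2 : bary2 B2 = 1 - p2.
  have [_ [w /bary2_segment13 w0 <-]] := K'B2.
  by have [_ -> _] := baryS2 p2 (S3 p3 w); have [_ -> _] := baryS3 p3 w; rewrite w0; ring.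
have bary3B3 : bary3 B3 = 1 - p3.
  have [_ [w /bary3_segment12 w0 <-]] := K'B3.
  by have [_ _ ->] := baryS3 p3 (S1 p1 w); have [_ _ ->] := baryS1 p1 w; rewrite w0; ring.
have {K'B1} K'B1 := K'B1.1; have {K'B2} K'B2 := K'B2.1; have {K'B3} K'B3 := K'B3.1.
have [b11 b12 b13] := K'T _ K'B1; have [b21 b22 b23] := K'T _ K'B2.
have [b31 b32 b33] := K'T _ K'B3.
have sB1 := bary_sum B1; have sB2 := bary_sum B2; have sB3 := bary_sum B3.
have [rho rho0 S0rho] := simS0.
(* [rho] is the distance from [B1] to [B2]. Its square is v^2 + v w + w^2 with v and v + w in (-1,
   0), hence at most v^2 or (v + w)^2 according to the sign of w. *)
have rho1 : rho < 1.
  have /(congr1 (fun x => x ^+ 2)) := S0rho A1 A2.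
  rewrite exprMn !edist_sqr_bary S0A1 S0A2 a12 a13 a22 a23.
  set v := bary2 B1 - bary2 B2; set w := bary3 B1 - bary3 B2.
  have : v ^+ 2 + v * w + w ^+ 2 < 1.
    have v0 : v < 0 by rewrite /v; lra.
    have v1 : - 1 < v by rewrite /v; lra.
    have vw0 : v + w < 0 by rewrite /v /w; lra.
    have vw1 : - 1 < v + w by rewrite /v /w; lra.
    by have [w0|w0] := leP w 0; nra.
  move=> vw1 vwE; rewrite -(@ltr_pXn2r _ 2) ?nnegrE ?ltW // expr1n.
  by move: vw1; rewrite vwE; lra.
pose r := Num.max (p1 + p2 + p3) rho.
have r_ge : p1 + p2 + p3 <= r by rewrite le_max lexx.
have r01 : 0 <= r < 1 by rewrite le_max gt_max (ltW rho0) p_lt1 rho1 orbT.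
have Fr f : F f -> similarity_le r f.
  have Fr' : forall f, F' f -> similarity_le r f by apply: small_maps; lra.
  move=> /FP[] ->; try (by apply: Fr'; rewrite /F' /= !inE eqxx ?orbT).
  by exists rho => //; rewrite rho0 le_max lexx orbT.
have KT : K `<=` @triangle R.
  apply: (invariant_subset (F := F) (r := r)) => //; first by rewrite {1}KF.
    exact: closed_triangle.
  move=> f /FP[] ->; try (by apply: triangleS; rewrite /F' /= !inE eqxx ?orbT).
  move=> _ [z [z1 z2 z3] <-]; rewrite /triangle /=; have [-> -> ->] := S0E z.
  by split; do 2?[apply: addr_ge0]; exact: mulr_ge0.
have closedK : closed K by apply: compact_closed => //; exact: norm_hausdorff.
have FK f : F f -> f @` K `<=` K.
  by move=> Ff z fz; rewrite KF; exists f.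
(* Applied below to [K'] and to the fixed points [A1], [A2], [A3]. *)
have subK X : compact X -> X `<=` \bigcup_(f in F) f @` X -> X `<=` K.
  by move=> cX XF; exact: (invariant_subset (F := F) (r := r)).
have K'K : K' `<=` K.
  by apply: subK => // z; rewrite {1}K'F => -[f /F'F Ff fz]; exists f.
have fixedK f z : F f -> f z = z -> K z.
  move=> Ff fz; apply: (subK [set z]) => //; first exact: compact_set1.
  by move=> _ ->; exists f => //; exists z.
have KA1 : K A1.
  apply: (fixedK _ _ F1); have [_ e2 e3] := baryS1 p1 A1.
  by apply: bary_inj; rewrite ?e2 ?e3 ?a12 ?a13 mulr0.
have KA2 : K A2.
  apply: (fixedK _ _ F2); have [_ e2 e3] := baryS2 p2 A2.
  by apply: bary_inj; rewrite ?e2 ?e3 ?a22 ?a23; ring.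
have KA3 : K A3.
  apply: (fixedK _ _ F3); have [_ e2 e3] := baryS3 p3 A3.
  by apply: bary_inj; rewrite ?e2 ?e3 ?a32 ?a33; ring.
(* [B1] lies in some piece of [K']. On the pieces of [S2] and [S3] the first coordinate is at most
   p2 or p3, below 1 - p1, so the piece is that of [S1]. *)
have S1B1 : (S1 p1 @` K) B1.
  have : (\bigcup_(f in F') f @` K') B1 by rewrite -K'F.
  move=> [f /F'P[] -> [z K'z zB]]; first by exists z => //; exact: K'K.
  - have [e _ _] := baryS2 p2 z; have [z1 z2 z3] := K'T _ K'z; have := bary_sum z.
    by rewrite zB in e; nra.
  - have [e _ _] := baryS3 p3 z; have [z1 z2 z3] := K'T _ K'z; have := bary_sum z.
    by rewrite zB in e; nra.
have S2B2 : (S2 p2 @` K) B2.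
  have : (\bigcup_(f in F') f @` K') B2 by rewrite -K'F.
  move=> [f /F'P[] -> [z K'z zB]]; last first.
  - have [_ e _] := baryS3 p3 z; have [z1 z2 z3] := K'T _ K'z; have := bary_sum z.
    by rewrite zB in e; nra.
  - by exists z => //; exact: K'K.
  - have [_ e _] := baryS1 p1 z; have [z1 z2 z3] := K'T _ K'z; have := bary_sum z.
    by rewrite zB in e; nra.
have S3B3 : (S3 p3 @` K) B3.
  have : (\bigcup_(f in F') f @` K') B3 by rewrite -K'F.
  move=> [f /F'P[] -> [z K'z zB]]; last by exists z => //; exact: K'K.
  - have [_ _ e] := baryS1 p1 z; have [z1 z2 z3] := K'T _ K'z; have := bary_sum z.
    by rewrite zB in e; nra.
  - have [_ _ e] := baryS2 p2 z; have [z1 z2 z3] := K'T _ K'z; have := bary_sum z.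
    by rewrite zB in e; nra.
(* On the piece of [S1] the first coordinate is at least 1 - p1. At [B2] and [B3] it is at most p2
   and p3, so a common point must be the image of [A1] under [S0]. *)
have hub1 : S0 @` K `&` S1 p1 @` K = [set B1].
  apply/seteqP; split => [z|_ ->]; last by split => //; exists A1.
  move=> [[x Kx <-] [y Ky yx]]; have [x1 x2 x3] := KT _ Kx; have [y1 _ _] := KT _ Ky.
  have [ex _ _] := S0E x; have [ey _ _] := baryS1 p1 y; rewrite yx in ey.
  have [||||b2 b3] := @convex_comb_max _ (bary1 x) (bary2 x) (bary3 x)
    (1 - p1) (bary1 B2) (bary1 B3) x2 x3; [exact: bary_sum|lra|lra|nra|].
  by rewrite /= (@bary_inj _ x A1) // ?a12 ?a13.
have hub2 : S0 @` K `&` S2 p2 @` K = [set B2].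
  apply/seteqP; split => [z|_ ->]; last by split => //; exists A2.
  move=> [[x Kx <-] [y Ky yx]]; have [x1 x2 x3] := KT _ Kx; have [_ y2 _] := KT _ Ky.
  have [_ ex _] := S0E x; have [_ ey _] := baryS2 p2 y; rewrite yx in ey.
  have sx := bary_sum x.
  have [||||b3 b1] := @convex_comb_max _ (bary2 x) (bary3 x) (bary1 x)
    (1 - p2) (bary2 B3) (bary2 B1) x3 x1; [lra|lra|lra|nra|].
  by rewrite /= (@bary_inj _ x A2) // ?a22 ?a23 //; lra.
have hub3 : S0 @` K `&` S3 p3 @` K = [set B3].
  apply/seteqP; split => [z|_ ->]; last by split => //; exists A3.
  move=> [[x Kx <-] [y Ky yx]]; have [x1 x2 x3] := KT _ Kx; have [_ _ y3] := KT _ Ky.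
  have [_ _ ex] := S0E x; have [_ _ ey] := baryS3 p3 y; rewrite yx in ey.
  have sx := bary_sum x.
  have [||||b1 b2] := @convex_comb_max _ (bary3 x) (bary1 x) (bary2 x)
    (1 - p3) (bary3 B1) (bary3 B2) x1 x2; [lra|lra|lra|nra|].
  by rewrite /= (@bary_inj _ x A3) // ?a32 ?a33 //; lra.
(* The first coordinate is at least 1 - p1 on one piece and at most p2 on the other. *)
have disj12 : S1 p1 @` K `&` S2 p2 @` K = set0.
  apply/seteqP; split => // z [[x Kx <-] [y Ky yx]].
  have [x1 x2 x3] := KT _ Kx; have [y1 y2 y3] := KT _ Ky.
  have [ex _ _] := baryS1 p1 x; have [ey _ _] := baryS2 p2 y; rewrite yx in ey.
  by have := bary_sum y; nra.
have disj13 : S1 p1 @` K `&` S3 p3 @` K = set0.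
  apply/seteqP; split => // z [[x Kx <-] [y Ky yx]].
  have [x1 x2 x3] := KT _ Kx; have [y1 y2 y3] := KT _ Ky.
  have [ex _ _] := baryS1 p1 x; have [ey _ _] := baryS3 p3 y; rewrite yx in ey.
  by have := bary_sum y; nra.
have disj23 : S2 p2 @` K `&` S3 p3 @` K = set0.
  apply/seteqP; split => // z [[x Kx <-] [y Ky yx]].
  have [x1 x2 x3] := KT _ Kx; have [y1 y2 y3] := KT _ Ky.
  have [_ ex _] := baryS2 p2 x; have [_ ey _] := baryS3 p3 y; rewrite yx in ey.
  by have := bary_sum y; nra.
apply: (hub_attractor_dendrite (F := F) (f0 := S0) (r := r)) => //.
- exact: finite_seq.
- by move=> f /FP[] -> // _; [exists B1|exists B2|exists B3].
- by move=> f g /FP[] -> /FP[] -> // _ _ _; rewrite // setIC.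
Qed.
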